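(* The Strong Comparison Principle fails for the characteristic operator $\mathcal{T}$. Precisely: let $N\ge1$, $n=2N+1$, $R>0$, $B=B(0,R)\subseteq\mathbb{R}^n$, and define $u,v:B\to\mathbb{R}$ by $$u(x)=-\sqrt{R^2-|x_n|^2},\qquad v(x)=-\sqrt{R^2-|x|^2}.$$ Then $\mathcal{T}(u)=\mathcal{T}(v)=1/R$ in $B$ and $u\le v$ in $B$, and $u(x)=v(x)$ for all $x\in B$ of the form $x=(0,\dots,0,x_n)$, although $u\not\equiv v$ in $B$.
   Context: Coordinates in $\mathbb{R}^n=\mathbb{R}^{2N+1}$ are $x=(x_1,\dots,x_n)$; the first $N$ are the ''$x$-variables'', the next $N$ are the ''$y$-variables'', and the last one $x_n$ is the variable $t$. For $p=(p_x,p_y,p_t)\in\mathbb{R}^N\times\mathbb{R}^N\times\mathbb{R}$ let $\sigma(p)=(-p_y,p_x,1)^T$ and $A(p)=\sigma(p)\sigma(p)^T$. The characteristic operator acts on $C^2$ functions $u$ by $$\mathcal{T}u=\frac{1}{(1+|Du|^2)^{3/2}}\operatorname{tr}\big(A(Du)\,D^2u\big).$$ The Strong Comparison Principle is the assertion that, whenever $u,v\in C^2$ satisfy $\mathcal{T}(u)\ge\mathcal{T}(v)$ and $u\le v$ in a bounded open set $\Omega$, either $u<v$ in $\Omega$ or, if $u(x_0)=v(x_0)$ for some $x_0\in\Omega$, then $u\equiv v$ in $\Omega$. *)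

(* Defs.v *)
From HB Require Import structures.
From mathcomp Require Import all_boot all_order all_algebra.
From mathcomp Require Import all_classical all_reals all_analysis.
Set Implicit Arguments.
Unset Strict Implicit.
Unset Printing Implicit Defensive.
Import Order.TTheory GRing.Theory Num.Theory.
Import numFieldNormedType.Exports.
Local Open Scope classical_set_scope.
Local Open Scope ring_scope.

(* The norm of the library on ['rV[R]_n] is the sup norm, whence [enorm] for the
   Euclidean norm and [eball] for its balls centred at 0. *)
Definition enorm (R : realType) (n : nat) (x : 'rV[R]_n) : R :=
  Num.sqrt (\sum_(i < n) x 0 i ^+ 2).

Definition eball (R : realType) (n : nat) (r : R) : set 'rV[R]_n :=
  [set x | enorm x < r].
Arguments eball {R} n r.

Definition pderiv (R : realType) (n : nat) (i : 'I_n) (u : 'rV[R]_n -> R)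
    (x : 'rV[R]_n) : R :=
  'D_(delta_mx 0 i) u x.

Definition grad (R : realType) (n : nat) (u : 'rV[R]_n -> R) (x : 'rV[R]_n) :
    'rV[R]_n :=
  \row_i pderiv i u x.

Definition hessian (R : realType) (n : nat) (u : 'rV[R]_n -> R)
    (x : 'rV[R]_n) : 'M[R]_n :=
  \matrix_(i, j) pderiv i (pderiv j u) x.

(* Functions on [Omega] are represented by total functions; for [Omega] open the
   following only depend on the restriction to [Omega]. *)
Definition C1_on (R : realType) (n : nat) (Omega : set 'rV[R]_n)
    (u : 'rV[R]_n -> R) : Prop :=
  forall x, Omega x ->
    {for x, continuous u} /\
    forall i, derivable u x (delta_mx 0 i) /\ {for x, continuous (pderiv i u)}.

Definition C2_on (R : realType) (n : nat) (Omega : set 'rV[R]_n)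
    (u : 'rV[R]_n -> R) : Prop :=
  C1_on Omega u /\ forall i, C1_on Omega (pderiv i u).

(* A vector of R^(2N+1) is split as p = (p_x, p_y, p_t). *)
Definition xpart (R : realType) (N : nat) (p : 'rV[R]_(N + N + 1)) : 'rV[R]_N :=
  lsubmx (lsubmx p).

Definition ypart (R : realType) (N : nat) (p : 'rV[R]_(N + N + 1)) : 'rV[R]_N :=
  rsubmx (lsubmx p).

Definition tindex (N : nat) : 'I_(N + N + 1) := rshift (N + N) ord0.

Definition sigma (R : realType) (N : nat) (p : 'rV[R]_(N + N + 1)) :
    'cV[R]_(N + N + 1) :=
  (row_mx (row_mx (- ypart p) (xpart p)) (const_mx 1))^T.

Definition Amat (R : realType) (N : nat) (p : 'rV[R]_(N + N + 1)) :
    'M[R]_(N + N + 1) :=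
  sigma p *m (sigma p)^T.

Definition charop (R : realType) (N : nat) (u : 'rV[R]_(N + N + 1) -> R)
    (x : 'rV[R]_(N + N + 1)) : R :=
  ((1 + enorm (grad u x) ^+ 2) `^ (3 / 2))^-1
    * \tr (Amat (grad u x) *m hessian u x).

Definition strong_comparison_on (R : realType) (n : nat)
    (F : ('rV[R]_n -> R) -> 'rV[R]_n -> R) (Omega : set 'rV[R]_n) : Prop :=
  forall u v : 'rV[R]_n -> R,
    C2_on Omega u -> C2_on Omega v ->
    (forall x, Omega x -> F v x <= F u x) ->
    (forall x, Omega x -> u x <= v x) ->
    (forall x, Omega x -> u x < v x) \/ (forall x, Omega x -> u x = v x).

Definition strong_comparison_principle (R : realType) (n : nat)
    (F : ('rV[R]_n -> R) -> 'rV[R]_n -> R) : Prop :=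
  forall Omega : set 'rV[R]_n,
    open Omega -> bounded_set Omega -> strong_comparison_on F Omega.

Definition ufun (R : realType) (N : nat) (r : R) (x : 'rV[R]_(N + N + 1)) : R :=
  - Num.sqrt (r ^+ 2 - `|x 0 (tindex N)| ^+ 2).

Definition vfun (R : realType) (N : nat) (r : R) (x : 'rV[R]_(N + N + 1)) : R :=
  - Num.sqrt (r ^+ 2 - enorm x ^+ 2).

(* Main.v *)
Require Import Defs.
From HB Require Import structures.
From mathcomp Require Import all_boot all_order all_algebra.
From mathcomp Require Import all_classical all_reals all_analysis.
From mathcomp Require Import ring lra.
Import Order.TTheory GRing.Theory Num.Theory.
Import numFieldNormedType.Exports.
Local Open Scope classical_set_scope.
Local Open Scope ring_scope.

(** Both functions belong to one family.  For nonnegative weights w put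
    q(x) = sum_i w_i x_i^2 and f_w(x) = - sqrt (r^2 - q(x)).  Weights all equal
    to 1 give the lower half-sphere v; the weight 1 on t and 0 on the other
    variables gives the lower half-cylinder u.  They are treated at once by the
    weights [twgt a], equal to 1 on t and to an idempotent a elsewhere.

    With s = sqrt (r^2 - q(x)) > 0 one finds
      D_i f_w = w_i x_i / s,
      D_i D_j f_w = w_j delta_ij / s + (D_i f_w) (D_j f_w) / s
    ([pderiv_cap], [pderiv2_cap]).  Let p = D f_w.  As A(p) = sigma sigma^T has
    rank one, the trace is sigma^T (D^2 f_w) sigma, that is
      (sum_i w_i sigma_i^2) / s + <p, sigma>^2 / s.
    The x and y parts of p are orthogonal to those of sigma, so
    <p, sigma> = p_t ([grad_dot_sigma]).  They also have the same length, and
    a p = p away from t, so sum_i w_i sigma_i^2 = 1 + |p|^2 - p_t^2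
    ([twgt_sigma_sqr]).  The trace is therefore (1 + |p|^2) / s for every
    idempotent a.  Since the weights are idempotent, 1 + |p|^2 = r^2 / s^2, and
    dividing by its power 3/2 leaves 1/r ([charop_cap]).

    Thus u and v have the same curvature 1/r.  They are ordered because their
    weights are, agree on the t axis, where only t^2 enters q, and differ as
    soon as another coordinate is nonzero.  Such a pair contradicts strong
    comparison on the ball itself, a bounded open set, and hence the
    principle. *)

(** * Derivatives along lines *)

(** The directional derivative is the one-variable derivative of the
    restriction to a line; this gives access to the one-variable calculus. *)
Lemma is_derive_lineP (R : realType) (V : normedModType R) (f : V -> R)
    (x v : V) (df : R) :
  is_derive x v f df <-> is_derive (0 : R) 1 (fun h : R => f (h *: v + x)) df.
Proof.
set g := fun h : R => f (h *: v + x).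
have E : (fun h => h^-1 *: ((f \o shift x) (h *: v) - f x)) =
    (fun h => h^-1 *: ((g \o shift (0 : R)) (h *: (1 : R^o)) - g 0)).
  apply/funext => h; rewrite /g /= addr0 scale0r add0r.
  by rewrite -[h *: 1]/(h * 1) mulr1.
have dE : derivable f x v = derivable g (0 : R) 1 by rewrite /derivable E.
have vE : 'D_v f x = 'D_1 g (0 : R) by rewrite /derive E.
by split=> -[dv ev]; split; rewrite ?dE ?vE // -?dE -?vE.
Qed.

Lemma is_derive_comp_real (R : realType) (V : normedModType R) (f : R -> R)
    (g : V -> R) (x v : V) (df dg : R) :
  is_derive (g x) 1 f df -> is_derive x v g dg ->
  is_derive x v (f \o g) (df * dg).
Proof.
move=> fx /is_derive_lineP gx; apply/is_derive_lineP.
apply: (@is_derive1_comp _ f (fun h : R => g (h *: v + x))) => //.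
by rewrite scale0r add0r.
Qed.

Lemma is_derive_coord (R : realType) (n : nat) (x v : 'rV[R]_n) (j : 'I_n) :
  is_derive x v (fun y : 'rV[R]_n => y 0 j) (v 0 j).
Proof.
apply/is_derive_lineP.
have -> : (fun h : R => (h *: v + x) 0 j) = (v 0 j \*: id + cst (x 0 j)).
  by apply/funext => h; rewrite !mxE /= mulrC.
apply: is_derive_eq.
by rewrite addr0 -[_ *: _]/(_ * _) mulr1.
Qed.

(** * Half-ellipsoids and half-cylinders *)

Definition wsumsq (R : realType) (n : nat) (w : 'I_n -> R) (x : 'rV[R]_n) : R :=
  \sum_i w i * x 0 i ^+ 2.

(** The lower half of the quadric [wsumsq w x + z ^+ 2 = r ^+ 2], as a graph in
    the extra variable z; vanishing weights give cylinders. *)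
Definition cap (R : realType) (n : nat) (r : R) (w : 'I_n -> R)
    (x : 'rV[R]_n) : R :=
  - Num.sqrt (r ^+ 2 - wsumsq R n w x).
Arguments wsumsq {R n}.
Arguments cap {R n}.

Lemma continuous_wsumsq (R : realType) (n : nat) (w : 'I_n -> R) :
  continuous (wsumsq w).
Proof.
apply: continuous_big => [|i _ x]; first exact: add_continuous.
apply: (@continuousM _ _ (fun=> w i) (fun y : 'rV[R]_n => y 0 i ^+ 2)).
  exact: cst_continuous.
apply: (@continuous_comp _ _ _ (fun y : 'rV[R]_n => y 0 i) (fun z => z ^+ 2)).
  exact: coord_continuous.
exact: exprn_continuous.
Qed.

Lemma continuous_depth (R : realType) (n : nat) (r : R) (w : 'I_n -> R) :
  continuous (fun x : 'rV[R]_n => r ^+ 2 - wsumsq w x).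
Proof.
move=> x; apply: (@continuousB _ _ _ (fun=> r ^+ 2) (wsumsq w)).
  exact: cst_continuous.
exact: continuous_wsumsq.
Qed.

Lemma is_derive_depth (R : realType) (n : nat) (r : R) (w : 'I_n -> R)
    (x : 'rV[R]_n) (i : 'I_n) :
  is_derive x (delta_mx 0 i) (fun y => r ^+ 2 - wsumsq w y) (- (2 * w i * x 0 i)).
Proof.
have -> : (fun y => r ^+ 2 - wsumsq w y) = cst (r ^+ 2) -
    \sum_(j < n) (w j \*: ((fun y : 'rV[R]_n => y 0 j) ^+ 2)).
  by apply/funext => y; rewrite /= fct_sumE.
have D j := is_derive_coord R n x (delta_mx 0 i) j.
apply: is_derive_eq.
rewrite sub0r (bigD1 i) //= big1 ?addr0 => [|j /negbTE ji].
  rewrite !mxE !eqxx -![_ *: _]/(_ * _) /=; ring.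
by rewrite !mxE eqxx ji /= !scaler0.
Qed.

Lemma is_derive_cap (R : realType) (n : nat) (r : R) (w : 'I_n -> R)
    (x : 'rV[R]_n) (i : 'I_n) :
  0 < r ^+ 2 - wsumsq w x ->
  is_derive x (delta_mx 0 i) (cap r w)
    (w i * x 0 i / Num.sqrt (r ^+ 2 - wsumsq w x)).
Proof.
move=> d0; have s0 : 0 < Num.sqrt (r ^+ 2 - wsumsq w x) by rewrite sqrtr_gt0.
apply: is_derive_eq.
  apply: is_deriveN; apply: is_derive_comp_real (is_derive_depth R n r w x i).
  exact: is_derive1_sqrt.
by field; rewrite gt_eqF.
Qed.

Lemma is_derive_cap_slope (R : realType) (n : nat) (r : R) (w : 'I_n -> R)
    (x : 'rV[R]_n) (i j : 'I_n) :
  0 < r ^+ 2 - wsumsq w x ->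
  is_derive x (delta_mx 0 i)
    (fun y : 'rV[R]_n => w j * y 0 j / Num.sqrt (r ^+ 2 - wsumsq w y))
    (w j * (j == i)%:R / Num.sqrt (r ^+ 2 - wsumsq w x)
     + w i * x 0 i * (w j * x 0 j) / Num.sqrt (r ^+ 2 - wsumsq w x) ^+ 3).
Proof.
move=> d0; have s0 : 0 < Num.sqrt (r ^+ 2 - wsumsq w x) by rewrite sqrtr_gt0.
have Dinv : is_derive (r ^+ 2 - wsumsq w x) 1 (fun y => (Num.sqrt y)^-1)
    (- Num.sqrt (r ^+ 2 - wsumsq w x) ^- 2 *:
       (2 * Num.sqrt (r ^+ 2 - wsumsq w x))^-1).
  by apply: is_deriveV; [rewrite gt_eqF|exact: is_derive1_sqrt].
have -> : (fun y : 'rV[R]_n => w j * y 0 j / Num.sqrt (r ^+ 2 - wsumsq w y)) =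
    (w j \*: (fun y : 'rV[R]_n => y 0 j)) *
    ((fun y => (Num.sqrt y)^-1) \o (fun y => r ^+ 2 - wsumsq w y)) by [].
apply: is_derive_eq.
  apply: is_deriveM; first by apply: is_deriveZ; exact: is_derive_coord.
  apply: (is_derive_comp_real R _ (fun y => (Num.sqrt y)^-1)
    (fun y => r ^+ 2 - wsumsq w y)); exact: is_derive_depth.
rewrite !mxE eqxx /= -![_ *: _]/(_ * _) /=.
by field; rewrite gt_eqF.
Qed.

Lemma near_depth (R : realType) (n : nat) (r : R) (w : 'I_n -> R)
    (x : 'rV[R]_n) :
  0 < r ^+ 2 - wsumsq w x -> \forall y \near x, 0 < r ^+ 2 - wsumsq w y.
Proof. exact: (cvgr_gt _ (continuous_depth R n r w x)). Qed.

Lemma pderiv_cap (R : realType) (n : nat) (r : R) (w : 'I_n -> R)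
    (x : 'rV[R]_n) (i : 'I_n) :
  0 < r ^+ 2 - wsumsq w x ->
  pderiv i (cap r w) x = w i * x 0 i / Num.sqrt (r ^+ 2 - wsumsq w x).
Proof. by move=> d0; have D := is_derive_cap R n r w x i d0; exact: derive_val. Qed.

(** The formula for the gradient holds only where the radicand is positive;
    differentiating it at x is legitimate because this holds near x. *)
Lemma is_derive_pderiv_cap (R : realType) (n : nat) (r : R) (w : 'I_n -> R)
    (x : 'rV[R]_n) (i j : 'I_n) :
  0 < r ^+ 2 - wsumsq w x ->
  is_derive x (delta_mx 0 i) (pderiv j (cap r w))
    (w j * (j == i)%:R / Num.sqrt (r ^+ 2 - wsumsq w x)
     + w i * x 0 i * (w j * x 0 j) / Num.sqrt (r ^+ 2 - wsumsq w x) ^+ 3).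
Proof.
move=> d0; apply: near_eq_is_derive (is_derive_cap_slope R n r w x i j d0).
near=> y; rewrite pderiv_cap //; near: y; exact: near_depth.
Unshelve. all: by end_near. Qed.

Lemma pderiv2_cap (R : realType) (n : nat) (r : R) (w : 'I_n -> R)
    (x : 'rV[R]_n) (i j : 'I_n) :
  0 < r ^+ 2 - wsumsq w x ->
  pderiv i (pderiv j (cap r w)) x =
    w j * (j == i)%:R / Num.sqrt (r ^+ 2 - wsumsq w x)
     + w i * x 0 i * (w j * x 0 j) / Num.sqrt (r ^+ 2 - wsumsq w x) ^+ 3.
Proof.
by move=> d0; have D := is_derive_pderiv_cap R n r w x i j d0; exact: derive_val.
Qed.

(** * Regularity *)

Lemma near_eq_continuous (T U : topologicalType) (f g : T -> U) (x : T) :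
  (\forall y \near x, f y = g y) -> {for x, continuous f} ->
  {for x, continuous g}.
Proof.
move=> fg fx; have e : f x = g x by exact: nbhs_singleton fg.
apply: cvg_trans (near_eq_cvg fg) _; rewrite -e; exact: fx.
Qed.

Lemma C2_cap (R : realType) (n : nat) (r : R) (w : 'I_n -> R)
    (Omega : set 'rV[R]_n) :
  (forall x, Omega x -> 0 < r ^+ 2 - wsumsq w x) -> C2_on Omega (cap r w).
Proof.
move=> d0.
pose s y := Num.sqrt (r ^+ 2 - wsumsq w y).
pose c j (y : 'rV[R]_n) := w j * y 0 j.
have sC (x : 'rV[R]_n) : {for x, continuous s}.
  apply: (@continuous_comp _ _ _ (fun y => r ^+ 2 - wsumsq w y)).
    exact: continuous_depth.
  exact: sqrt_continuous.
have cC j (x : 'rV[R]_n) : {for x, continuous (c j)}.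
  apply: (@continuousM _ _ (fun=> w j) (fun y : 'rV[R]_n => y 0 j)).
    exact: cst_continuous.
  exact: coord_continuous.
have s3C (x : 'rV[R]_n) : {for x, continuous (fun y => s y ^+ 3)}.
  apply: (@continuous_comp _ _ _ s (fun z => z ^+ 3)); first exact: sC.
  exact: exprn_continuous.
have slopeC x j : Omega x -> {for x, continuous (pderiv j (cap r w))}.
  move=> /d0 dx; apply: (@near_eq_continuous _ _ (fun y => c j y * (s y)^-1)).
    near=> y; rewrite pderiv_cap //; near: y; exact: near_depth.
  apply: (@continuousM _ _ (c j)); first exact: cC.
  by apply: continuousV; [rewrite gt_eqF // sqrtr_gt0|exact: sC].
split=> [x Ox|j x Ox].
  split=> [|i]; first by apply: continuousN; exact: sC.
  split; last exact: slopeC.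
  by have D := is_derive_cap R n r w x i (d0 _ Ox); exact: ex_derive.
split=> [|i]; first exact: slopeC.
split.
  by have D := is_derive_pderiv_cap R n r w x i j (d0 _ Ox); exact: ex_derive.
apply: (@near_eq_continuous _ _ ((fun y => w j * (j == i)%:R * (s y)^-1)
    + (fun y => c i y * c j y * (s y ^+ 3)^-1))).
  near=> y; rewrite pderiv2_cap //; near: y; exact/near_depth/d0.
have s0 : s x != 0 by rewrite gt_eqF // sqrtr_gt0 d0.
apply: continuousD.
  apply: (@continuousM _ _ (fun=> w j * (j == i)%:R)); first exact: cst_continuous.
  by apply: continuousV => //; exact: sC.
apply: (@continuousM _ _ (fun y => c i y * c j y)).
  by apply: (@continuousM _ _ (c i)); exact: cC.
by apply: continuousV; [rewrite expf_neq0|exact: s3C].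
Unshelve. all: by end_near. Qed.

(** * The operator on the family *)

Lemma enorm_sqr (R : realType) (n : nat) (x : 'rV[R]_n) :
  enorm x ^+ 2 = \sum_i x 0 i ^+ 2.
Proof. by rewrite sqr_sqrtr // sumr_ge0 // => i _; exact: sqr_ge0. Qed.

Lemma enorm_ge0 (R : realType) (n : nat) (x : 'rV[R]_n) : 0 <= enorm x.
Proof. exact: sqrtr_ge0. Qed.

Lemma mxtrace_rank1_mul (R : comRingType) (n : nat) (s : 'cV[R]_n)
    (H : 'M[R]_n) :
  \tr (s *m s^T *m H) = \sum_i \sum_j s i 0 * H i j * s j 0.
Proof.
rewrite -mulmxA mxtrace_mulC /mxtrace big_ord1 mxE exchange_big /=.
apply: eq_bigr => j _; rewrite mxE mulr_suml.
by apply: eq_bigr => i _; rewrite !mxE.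
Qed.

Lemma big_split_xyt (R : nmodType) (N : nat) (F : 'I_(N + N + 1) -> R) :
  \sum_i F i = \sum_(i < N) F (lshift 1 (lshift N i))
    + \sum_(i < N) F (lshift 1 (rshift N i)) + F (tindex N).
Proof. by rewrite big_split_ord big_ord1 /= big_split_ord. Qed.

Lemma lshift_eq_tindex (N : nat) (i : 'I_(N + N)) :
  (lshift 1 i == tindex N) = false.
Proof. exact: eq_lrshift. Qed.

(** The weight a is kept general so that the half-cylinder (a = 0) and the
    half-sphere (a = 1) share one computation, which uses only [a * a = a]. *)
Definition twgt (R : realType) (N : nat) (a : R) (i : 'I_(N + N + 1)) : R :=
  if i == tindex N then 1 else a.
Arguments twgt {R N}.

Lemma sigma_x (R : realType) (N : nat) (p : 'rV[R]_(N + N + 1)) (i : 'I_N) :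
  sigma p (lshift 1 (lshift N i)) 0 = - p 0 (lshift 1 (rshift N i)).
Proof. by rewrite mxE row_mxEl row_mxEl !mxE. Qed.

Lemma sigma_y (R : realType) (N : nat) (p : 'rV[R]_(N + N + 1)) (i : 'I_N) :
  sigma p (lshift 1 (rshift N i)) 0 = p 0 (lshift 1 (lshift N i)).
Proof. by rewrite mxE row_mxEl row_mxEr !mxE. Qed.

Lemma sigma_t (R : realType) (N : nat) (p : 'rV[R]_(N + N + 1)) :
  sigma p (tindex N) 0 = 1.
Proof. by rewrite mxE row_mxEr !mxE. Qed.

(** (-p_y, p_x) is orthogonal to (p_x, p_y), so only t contributes. *)
Lemma grad_dot_sigma (R : realType) (N : nat) (p : 'rV[R]_(N + N + 1)) :
  \sum_i p 0 i * sigma p i 0 = p 0 (tindex N).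
Proof.
rewrite big_split_xyt sigma_t mulr1 -big_split /= big1 ?add0r // => i _.
by rewrite sigma_x sigma_y; ring.
Qed.

(** (-p_y, p_x) and (p_x, p_y) have the same length, and the hypothesis lets
    the weight a be absorbed by p. *)
Lemma twgt_sigma_sqr (R : realType) (N : nat) (a : R)
    (p : 'rV[R]_(N + N + 1)) : a * a = a ->
  (forall i, i != tindex N -> a * p 0 i = p 0 i) ->
  \sum_i twgt a i * sigma p i 0 ^+ 2 = 1 + enorm p ^+ 2 - p 0 (tindex N) ^+ 2.
Proof.
move=> aa ap; rewrite enorm_sqr !big_split_xyt /twgt eqxx sigma_t.
under eq_bigr => i _ do rewrite lshift_eq_tindex sigma_x sqrrN expr2 mulrA
  ap ?lshift_eq_tindex // -expr2.
under [X in _ + X + _ = _]eq_bigr => i _ do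
  rewrite lshift_eq_tindex sigma_y expr2 mulrA ap ?lshift_eq_tindex // -expr2.
by ring.
Qed.

(** The trace is (1 + |p|^2) / s and 1 + |p|^2 = (r / s)^2; none of this
    depends on a, so the two surfaces have the same curvature. *)
Lemma charop_cap (R : realType) (N : nat) (r a : R) (x : 'rV[R]_(N + N + 1)) :
  0 < r -> a * a = a -> 0 < r ^+ 2 - wsumsq (twgt a) x ->
  charop (cap r (twgt a)) x = 1 / r.
Proof.
move=> r0 aa d0; set s := Num.sqrt (r ^+ 2 - wsumsq (twgt a) x).
have s0 : 0 < s by rewrite sqrtr_gt0.
have s2 : s ^+ 2 = r ^+ 2 - wsumsq (twgt a) x by rewrite sqr_sqrtr // ltW.
have w2 (i : 'I_(N + N + 1)) : twgt a i * twgt a i = twgt a i.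
  by rewrite /twgt; case: ifP; rewrite ?mulr1.
pose p := grad (cap r (twgt a)) x.
have pE i : p 0 i = twgt a i * x 0 i / s by rewrite mxE pderiv_cap.
have p2 : 1 + enorm p ^+ 2 = (r / s) ^+ 2.
  have -> : enorm p ^+ 2 = wsumsq (twgt a) x / s ^+ 2.
    (* Here the squared weights of |p|^2 collapse to the weights of q. *)
    rewrite enorm_sqr mulr_suml; apply: eq_bigr => i _.
    by rewrite pE -[in RHS]w2; field; rewrite gt_eqF.
  rewrite (_ : wsumsq _ x = r ^+ 2 - s ^+ 2); last by rewrite s2; ring.
  by field; rewrite gt_eqF.
rewrite /charop -/p p2 -powR_mulrn ?divr_ge0 ?ltW // -powRrM.
have -> : 2 * (3 / 2) = 3%:R :> R by field.
rewrite powR_mulrn ?divr_ge0 ?ltW //.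
have -> : \tr (Amat p *m hessian (cap r (twgt a)) x) =
    (\sum_i twgt a i * sigma p i 0 ^+ 2) / s
    + (\sum_i p 0 i * sigma p i 0) ^+ 2 / s.
  rewrite mxtrace_rank1_mul [in X in _ + X]expr2 mulr_suml !mulr_suml -big_split.
  apply: eq_bigr => i _ /=; rewrite mulr_sumr.
  (* The Hessian is its diagonal part plus the rank-one part p^T p / s. *)
  transitivity (\sum_j (sigma p i 0 * (twgt a j * (j == i)%:R / s) * sigma p j 0
     + p 0 i * sigma p i 0 * (p 0 j * sigma p j 0) / s)).
    apply: eq_bigr => j _; rewrite [hessian _ _ i j]mxE pderiv2_cap // -/s !pE.
    by field; rewrite gt_eqF.
  rewrite big_split /= -mulr_suml; congr (_ + _).
  rewrite (bigD1 i) //= eqxx big1 => [|j /negbTE ->]; first by rewrite addr0 mulr1; ring.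
  by rewrite mulr0 mul0r mulr0 mul0r.
rewrite grad_dot_sigma twgt_sigma_sqr // => [|i /negbTE it].
  rewrite p2; by field; rewrite !gt_eqF.
by rewrite pE /twgt it !mulrA aa.
Qed.

(** * The half-cylinder and the half-sphere over the ball *)

Lemma ufun_cap (R : realType) (N : nat) (r : R) : @ufun R N r = cap r (twgt 0).
Proof.
apply/funext => x; rewrite /ufun /cap /wsumsq big_split_xyt /twgt eqxx mul1r.
rewrite !big1 ?add0r => [|i _|i _]; rewrite ?lshift_eq_tindex ?mul0r //.
by rewrite real_normK // num_real.
Qed.

Lemma vfun_cap (R : realType) (N : nat) (r : R) : @vfun R N r = cap r (twgt 1).
Proof.
apply/funext => x; rewrite /vfun /cap enorm_sqr; congr (- Num.sqrt (_ - _)).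
by apply: eq_bigr => i _; rewrite /twgt if_same mul1r.
Qed.

Lemma wsumsq_le_enorm (R : realType) (n : nat) (w : 'I_n -> R) (x : 'rV[R]_n) :
  (forall i, w i <= 1) -> wsumsq w x <= enorm x ^+ 2.
Proof.
move=> w1; rewrite enorm_sqr; apply: ler_sum => i _.
by rewrite ler_piMl ?sqr_ge0.
Qed.

Lemma eball_depth_gt0 (R : realType) (n : nat) (r : R) (w : 'I_n -> R)
    (x : 'rV[R]_n) :
  (forall i, w i <= 1) -> eball n r x -> 0 < r ^+ 2 - wsumsq w x.
Proof.
move=> w1 xr; rewrite subr_gt0 (le_lt_trans (wsumsq_le_enorm _ _ _ x w1)) //.
have r0 : 0 < r by apply: le_lt_trans xr; exact: enorm_ge0.
by rewrite ltr_pXn2r // ?nnegrE ?enorm_ge0 // ltW.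
Qed.

Lemma open_eball (R : realType) (n : nat) (r : R) : open (@eball R n r).
Proof.
have nC : continuous (@enorm R n).
  have -> : @enorm R n = (fun x => Num.sqrt (wsumsq (fun=> 1) x)).
    by apply/funext => x; congr Num.sqrt; apply: eq_bigr => i _; rewrite mul1r.
  move=> x; apply: (@continuous_comp _ _ _ (wsumsq (fun=> 1))).
    exact: continuous_wsumsq.
  exact: sqrt_continuous.
by apply: (@open_comp _ _ _ [set y : R | y < r]) => [x _|]; [exact: nC|exact: open_lt].
Qed.

(** The sup norm that defines boundedness is dominated by the Euclidean one. *)
Lemma bounded_eball (R : realType) (n : nat) (r : R) :
  bounded_set (@eball R n r).
Proof.
exists r; split; first exact: num_real.
move=> M rM x xr; apply: ltW; apply: le_lt_trans rM; apply: le_trans (ltW xr).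
rewrite [`|x|]mx_normrE; apply: bigmax_le => [|[i j] _ /=]; first exact: enorm_ge0.
rewrite -ler_sqr ?nnegrE ?enorm_ge0 // enorm_sqr real_normK ?num_real //.
by rewrite ord1 (bigD1 j) //= lerDl sumr_ge0 // => k _; exact: sqr_ge0.
Qed.

(** Touching at one point rules out strict inequality, differing at another
    rules out equality. *)
Lemma strong_comparison_on_counterexample (R : realType) (n : nat)
    (F : ('rV[R]_n -> R) -> 'rV[R]_n -> R) (Omega : set 'rV[R]_n)
    (u v : 'rV[R]_n -> R) :
  C2_on Omega u -> C2_on Omega v ->
  (forall x, Omega x -> F v x <= F u x) ->
  (forall x, Omega x -> u x <= v x) ->
  (exists x, Omega x /\ u x = v x) -> (exists x, Omega x /\ u x <> v x) ->
  ~ strong_comparison_on F Omega.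
Proof.
move=> Cu Cv Fuv uv [x [Ox ux]] [y [Oy uy]] /(_ u v Cu Cv Fuv uv) [lt|eq].
  by have := lt x Ox; rewrite ux ltxx.
exact: uy (eq y Oy).
Qed.

Theorem mainTheorem6 (R : realType) (N : nat) (hN : (1 <= N)%N) (r : R)
    (hr : 0 < r) :
  let B : set 'rV[R]_(N + N + 1) := eball (N + N + 1) r in
  let u : 'rV[R]_(N + N + 1) -> R := @ufun R N r in
  let v : 'rV[R]_(N + N + 1) -> R := @vfun R N r in
  ~ strong_comparison_principle (@charop R N) /\
  ~ strong_comparison_on (@charop R N) B /\
  open B /\ bounded_set B /\
  C2_on B u /\ C2_on B v /\
  (forall x, B x -> charop u x = 1 / r /\ charop v x = 1 / r) /\
  (forall x, B x -> u x <= v x) /\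
  (forall x, B x -> (forall i, i != tindex N -> x 0 i = 0) -> u x = v x) /\
  (exists x, B x /\ u x <> v x).
Proof.
move=> B u v.
have w1 (b : bool) i : twgt b%:R i <= 1 :> R.
  by rewrite /twgt; case: ifP => // _; case: b.
have d0 (b : bool) x : B x -> 0 < r ^+ 2 - wsumsq (twgt b%:R) x.
  by apply: eball_depth_gt0; exact: w1.
have uE : u = cap r (twgt false%:R) by exact: ufun_cap.
have vE : v = cap r (twgt true%:R) by exact: vfun_cap.
have Bo : open B := open_eball R _ r.
have Bb : bounded_set B := bounded_eball R _ r.
have Cu : C2_on B u by rewrite uE; apply: C2_cap; exact: d0.
have Cv : C2_on B v by rewrite vE; apply: C2_cap; exact: d0.
have Tuv x : B x -> charop u x = 1 / r /\ charop v x = 1 / r.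
  by move=> Bx; rewrite uE vE !charop_cap ?mul0r ?mul1r //; exact: d0.
have uv x : B x -> u x <= v x.
  move=> Bx; rewrite uE vE lerN2; apply: ler_wsqrtr; apply: lerB => //.
  apply: ler_sum => i _; rewrite ler_wpM2r ?sqr_ge0 // /twgt.
  by case: ifP.
have uvt (x : 'rV[R]_(N + N + 1)) : (forall i, i != tindex N -> x 0 i = 0) -> u x = v x.
  move=> x0; rewrite uE vE; congr (- Num.sqrt (_ - _)).
  apply: eq_bigr => i _; rewrite /twgt; case: ifPn => // /x0 ->.
  by rewrite expr0n !mulr0.
have [x [Bx ux]] : exists x, B x /\ u x <> v x.
  (* The point with first x coordinate r / 2 and all others 0, which exists
     because N is positive: there u = - r but v > - r. *)
  pose k : 'I_(N + N + 1) := lshift 1 (lshift N (Ordinal hN)).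
  pose x : 'rV[R]_(N + N + 1) := (r / 2) *: delta_mx 0 k.
  have S (w : 'I_(N + N + 1) -> R) : wsumsq w x = w k * (r / 2) ^+ 2.
    rewrite /wsumsq (bigD1 k) //= big1 => [|i /negbTE ik].
      by rewrite !mxE !eqxx mulr1 addr0.
    by rewrite !mxE ik andbF mulr0 expr0n mulr0.
  have Bx : B x.
    rewrite /B /eball /= -ltr_sqr ?nnegrE ?enorm_ge0 ?ltW // enorm_sqr.
    have -> : \sum_i x 0 i ^+ 2 = wsumsq (fun=> 1) x.
      by apply: eq_bigr => i _; rewrite mul1r.
    by rewrite S; nra.
  exists x; split=> // /eqP; rewrite uE vE eqr_opp eqr_sqrt; [|exact/ltW/d0|exact/ltW/d0].
  rewrite !S /twgt lshift_eq_tindex mul0r mul1r => /eqP e.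
  have r2 : 0 < r ^+ 2 by rewrite exprn_gt0.
  by move: e; lra.
have notB : ~ strong_comparison_on (@charop R N) B.
  have Tle y : B y -> charop v y <= charop u y by move=> /Tuv [-> ->].
  apply: (strong_comparison_on_counterexample _ _ _ _ _ _ Cu Cv Tle uv).
    exists 0; split; last by apply: uvt => i _; rewrite mxE.
    rewrite /B /eball /= /enorm big1 ?sqrtr0 // => i _.
    by rewrite mxE expr0n.
  by exists x.
split; first by move=> scp; apply: notB; exact: scp.
exact: (conj notB (conj Bo (conj Bb (conj Cu (conj Cv (conj Tuv (conj uv
  (conj (fun y _ => uvt y) (ex_intro _ x (conj Bx ux)))))))))).
Qed.
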